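(* We have \[ bt(n)=(1+o(1))\frac{\log n}{\log\log n}\quad (n\to\infty). \]
   Context: A permutation is any finite sequence of distinct positive integers; an $n$-permutation is a permutation of $[n]=\{1,\dots,n\}$. Two permutations $(x_1,\dots,x_k)$ and $(y_1,\dots,y_k)$ are similar if $x_i<x_j \iff y_i<y_j$ for all $1\le i<j\le k$. A block of $\pi$ is a subsequence of $\pi$ whose index set is a segment of consecutive integers. A pair of block twins in $\pi$ is a pair of similar blocks of $\pi$ with disjoint index sets; its length is the length of one of the blocks. $bt(\pi)$ is the largest length of a pair of block twins in $\pi$ and $bt(n)=\min\{bt(\pi):\pi \text{ an } n\text{-permutation}\}$. *)

(* Defs.v *)
From mathcomp Require Import all_boot.

Set Implicit Arguments.
Unset Strict Implicit.
Unset Printing Implicit Defensive.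

(* Permutations are sequences of naturals in one-line notation; indices start
   at 0, whereas the entries of an n-permutation are 1, ..., n. *)

Definition similar (x y : seq nat) : bool :=
  (size x == size y) &&
  [forall j : 'I_(size x), forall i : 'I_j,
     (nth 0 x i < nth 0 x j) == (nth 0 y i < nth 0 y j)].

(* The block of s with index set {i, ..., i + l - 1}, when i + l <= size s. *)
Definition block (s : seq nat) (i l : nat) : seq nat := take l (drop i s).

Definition block_twins (s : seq nat) (i j l : nat) : bool :=
  [&& i + l <= size s, j + l <= size s,
      (i + l <= j) || (j + l <= i)
    & similar (block s i l) (block s j l)].

(* Two empty blocks are twins of length 0, so bt_perm s = 0 when size s <= 1. *)
Definition bt_perm (s : seq nat) : nat :=
  \max_(l < (size s).+1 |
        [exists i : 'I_(size s).+1, exists j : 'I_(size s).+1,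
           block_twins s i j l]) l.

(* The minimum over all n-permutations: the initial value of the fold is
   attained at the identity, which is one of them. *)
Definition bt (n : nat) : nat :=
  \big[minn/bt_perm (iota 1 n)]_(s <- permutations (iota 1 n)) bt_perm s.

(* Main.v *)
Require Import Defs.
From mathcomp Require Import all_boot all_order all_algebra.
From mathcomp Require Import all_classical all_reals all_analysis.
From mathcomp Require Import zify ring lra.

(* Lower bound: an n-permutation has n %/ l consecutive blocks of length l and
   only l! patterns, so l (l! + 1) <= n forces twins of length l, and every
   l up to ln n / ln (ln n) - 2 qualifies.
   Upper bound: a union bound over pairs of blocks loses a factor 2. Instead, twin-free
   words of distinct letters over a large alphabet are built letter by letter,
   with Rosenfeld's counting method in place of the Lovasz local lemma. The new
   block is excluded by at most n earlier blocks, each forbidding a fraction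
   about 1 / l! of the extensions, so n 2^(l+1) <= l! suffices. Replacing letters
   by their ranks turns the word into a permutation with the same twins. *)

Set Implicit Arguments.
Unset Strict Implicit.
Unset Printing Implicit Defensive.

Import Order.TTheory GRing.Theory Num.Theory.
Import numFieldNormedType.Exports.
(* [similar] must not denote the similarity of matrices. *)
Import Defs.

(** * Similarity of sequences *)

Lemma similarP (x y : seq nat) :
  reflect (size x = size y /\ forall i j, i < j -> j < size x ->
             (nth 0 x i < nth 0 x j) = (nth 0 y i < nth 0 y j))
          (similar x y).
Proof.
apply: (iffP andP) => [[/eqP sxy /forallP H]|[sxy H]]; split=> //.
- move=> i j ij jx.
  by have /forallP/(_ (Ordinal ij))/eqP := H (Ordinal jx).
- exact/eqP.
- by apply/forallP => j; apply/forallP => i; apply/eqP; apply: H.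
Qed.

Lemma similar_size (x y : seq nat) : similar x y -> size x = size y.
Proof. by case/similarP. Qed.

Lemma similarxx (x : seq nat) : similar x x.
Proof. by apply/similarP. Qed.

Lemma similar_sym (x y : seq nat) : similar x y = similar y x.
Proof.
by apply/similarP/similarP => -[sxy H]; split=> // i j ij; rewrite -?sxy ?sxy => jx;
  rewrite H // ?sxy // -sxy.
Qed.

Lemma similar_trans (y x z : seq nat) : similar x y -> similar y z -> similar x z.
Proof.
move=> /similarP[sxy Hxy] /similarP[syz Hyz]; apply/similarP; split=> [|i j ij jx].
  by rewrite sxy.
by rewrite Hxy // Hyz // -sxy.
Qed.

Lemma similar_block (i l : nat) (x y : seq nat) :
  similar x y -> similar (block x i l) (block y i l).
Proof.
move=> /similarP[sxy H]; apply/similarP; rewrite !size_take_min !size_drop sxy.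
split=> // a b ab; rewrite leq_min => /andP[bl by_].
by rewrite !nth_take ?(ltn_trans ab bl) // !nth_drop H // ?sxy; lia.
Qed.

(** Similarity only compares positions [i < j]; for [j < i] the comparison is the negation of the
    reversed one, because distinct entries are never equal. *)
Lemma similar_uniq_lt (x y : seq nat) (i j : nat) :
  uniq x -> uniq y -> similar x y -> i < size x -> j < size x ->
  (nth 0 x i < nth 0 x j) = (nth 0 y i < nth 0 y j).
Proof.
move=> ux uy /similarP[sxy H] ix jx.
case: (ltngtP i j) => [ij|ji|->]; [exact: H| |by rewrite !ltnn].
have nx : nth 0 x i != nth 0 x j by rewrite nth_uniq // gtn_eqF.
have ny : nth 0 y i != nth 0 y j by rewrite nth_uniq -?sxy // gtn_eqF.
rewrite ltn_neqAle nx /= leqNgt H // [RHS]ltn_neqAle ny /=.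
by rewrite [RHS]leqNgt.
Qed.

(** * Ranks of letters *)

Definition rank (s : seq nat) (a : nat) : nat := count (fun b => b < a) s.

Lemma leq_rank (s : seq nat) (a b : nat) : a <= b -> rank s a <= rank s b.
Proof. by move=> ab; apply: sub_count => c /= ca; apply: leq_trans ca ab. Qed.

Lemma ltn_rank (s : seq nat) (a b : nat) :
  a \in s -> (rank s a < rank s b) = (a < b).
Proof.
move=> sa; case: (ltnP a b) => [ab|]; last first.
  by move=> /(leq_rank s); rewrite ltnNge => ->.
have -> : rank s b = rank s a + count (fun c => a <= c < b) s.
  rewrite /rank -count_predUI [X in _ + X](@eq_count _ _ pred0) ?count_pred0 ?addn0.
    by apply: eq_count => c /=; lia.
  by move=> c /=; lia.
rewrite -addn1 leq_add2l -has_count; apply/hasP; exists a => //=; lia.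
Qed.

Lemma rank_inj (s : seq nat) : {in s &, injective (rank s)}.
Proof.
move=> a b sa sb e; apply/eqP; rewrite eqn_leq.
by rewrite (leqNgt a) (leqNgt b) -(ltn_rank a sb) -(ltn_rank b sa) e !ltnn.
Qed.

Lemma rank_lt_size (s : seq nat) (a : nat) : a \in s -> rank s a < size s.
Proof.
move=> sa; rewrite -(count_predC (fun b => b < a) s) -/(rank s a) -addn1 leq_add2l.
by rewrite -has_count; apply/hasP; exists a => //=; rewrite ltnn.
Qed.

Lemma count_nth_ord (p : pred nat) (s : seq nat) :
  count p s = \sum_(i < size s) p (nth 0 s i).
Proof. by rewrite -sum1_count big_mkcond (big_nth 0) big_mkord. Qed.

(** Similarity forces equal ranks at each position, and a letter is determined by its rank in the
    common set of letters. *)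
Lemma similar_perm_eq (x y : seq nat) :
  uniq x -> similar x y -> perm_eq x y -> x = y.
Proof.
move=> ux sim pxy; have uy : uniq y by rewrite -(perm_uniq pxy).
have sxy := similar_size sim.
apply: (@eq_from_nth _ 0) => // i ix; apply: (@rank_inj x).
- exact: mem_nth.
- by rewrite (perm_mem pxy) mem_nth // -sxy.
rewrite [RHS](permP pxy) /rank !count_nth_ord -sxy; apply: eq_bigr => j _.
by rewrite (similar_uniq_lt ux uy sim).
Qed.

(** * Block twins and the extremal function *)

Lemma size_block (s : seq nat) (i m : nat) : i + m <= size s -> size (block s i m) = m.
Proof. by move=> H; rewrite size_take_min size_drop; lia. Qed.

Definition has_twins (l : nat) (s : seq nat) : bool :=
  [exists i : 'I_(size s).+1, exists j : 'I_(size s).+1, block_twins s i j l].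

Lemma has_twinsP (l : nat) (s : seq nat) :
  reflect (exists i j, [/\ i + l <= j, j + l <= size s & similar (block s i l) (block s j l)])
          (has_twins l s).
Proof.
apply: (iffP existsP) => [[i /existsP[j /and4P[il jl /orP[ij|ji] sim]]]|[i [j [ij jl sim]]]].
- by exists i, j.
- by exists j, i; split=> //; rewrite similar_sym.
have lti : i < (size s).+1 by lia.
have ltj : j < (size s).+1 by lia.
exists (Ordinal lti); apply/existsP; exists (Ordinal ltj).
by apply/and4P; split=> //=; [lia|rewrite ij].
Qed.

(** Prefixes of twins are twins, so excluding one length excludes all larger ones. *)
Lemma has_twinsW (l m : nat) (s : seq nat) : l <= m -> has_twins m s -> has_twins l s.
Proof.
move=> lm /has_twinsP[i [j [ij jm sim]]]; apply/has_twinsP; exists i, j; split; [lia|lia|].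
by have := similar_block 0 l sim; rewrite /block !drop0 !take_takel.
Qed.

Lemma bt_perm_ge (l : nat) (s : seq nat) : has_twins l s -> l <= bt_perm s.
Proof.
move=> tw; have ls : l < (size s).+1 by case/has_twinsP: tw => i [j [ij jl _]]; lia.
by rewrite /bt_perm (bigD1 (Ordinal ls)) //= leq_max leqnn.
Qed.

Lemma bt_perm_lt (l : nat) (s : seq nat) : 0 < l -> ~~ has_twins l s -> bt_perm s < l.
Proof.
case: l => // l _ ntw; rewrite ltnS; apply/bigmax_leqP => m tw; rewrite leqNgt.
by apply: contra ntw => lm; apply: has_twinsW lm tw.
Qed.

Lemma bt_ge (m n : nat) :
  (forall s, perm_eq s (iota 1 n) -> m <= bt_perm s) -> m <= bt n.
Proof.
move=> H; rewrite /bt big_seq; elim/big_ind: _ => [|a b ma mb|s].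
- exact: H.
- by rewrite leq_min ma.
- by rewrite mem_permutations => /H.
Qed.

Lemma bt_le (n : nat) (s : seq nat) : perm_eq s (iota 1 n) -> bt n <= bt_perm s.
Proof.
rewrite -mem_permutations /bt.
elim: (permutations _) => // t r IH; rewrite inE big_cons geq_min => /orP[/eqP->|/IH ->].
  by rewrite leqnn.
by rewrite orbT.
Qed.

(** * Standardization of words to permutations *)

Definition standardize (s : seq nat) : seq nat := [seq (rank s a).+1 | a <- s].

Lemma standardize_perm (s : seq nat) :
  uniq s -> perm_eq (standardize s) (iota 1 (size s)).
Proof.
move=> us; have ust : uniq (standardize s).
  by rewrite map_inj_in_uniq // => a b sa sb [] /(rank_inj sa sb).
have sub : {subset standardize s <= iota 1 (size s)}.
  by move=> _ /mapP[a sa ->]; rewrite mem_iota /= add1n !ltnS rank_lt_size.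
apply: uniq_perm => //; first exact: iota_uniq.
by have [] := uniq_min_size ust sub; rewrite // size_map size_iota.
Qed.

Lemma similar_standardize (s : seq nat) : similar (standardize s) s.
Proof.
apply/similarP; rewrite size_map; split=> // i j ij js.
have si := ltn_trans ij js.
by rewrite !(nth_map 0) ?ltnS ?ltn_rank ?mem_nth.
Qed.

Lemma standardize_twins (l : nat) (s : seq nat) :
  has_twins l (standardize s) -> has_twins l s.
Proof.
move=> /has_twinsP[i [j []]]; rewrite size_map => ij jl sim.
apply/has_twinsP; exists i, j; split=> //.
have st k : similar (block (standardize s) k l) (block s k l).
  exact/similar_block/similar_standardize.
by apply: similar_trans (st j); apply: similar_trans sim; rewrite similar_sym.
Qed.

Lemma bt_lt (l : nat) (s : seq nat) :
  0 < l -> uniq s -> ~~ has_twins l s -> bt (size s) < l.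
Proof.
move=> l0 us ntw; apply: leq_ltn_trans (bt_le (standardize_perm us)) _.
by apply: bt_perm_lt => //; apply: contra ntw; apply: standardize_twins.
Qed.

(** * Words over a finite alphabet and their patterns *)

Fixpoint words (K N : nat) : seq (seq nat) :=
  if N is N'.+1 then [seq x :: s | x <- iota 0 K, s <- words K N'] else [:: [::]].

Lemma size_words (K N : nat) : size (words K N) = K ^ N.
Proof. by elim: N => //= N IH; rewrite size_allpairs size_iota IH expnS. Qed.

Lemma mem_words (K N : nat) (w : seq nat) :
  (w \in words K N) = (size w == N) && all (fun x => x < K) w.
Proof.
elim: N w => [|N IH] [|x s] //=; first by apply/allpairsP => -[[]] /= ? ? [].
rewrite eqSS andbCA -IH; apply/allpairsP/andP => [[[y t] [/= yK tN [-> ->]]]|[xK sN]].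
  by move: yK; rewrite mem_iota.
by exists (x, s); rewrite mem_iota.
Qed.

Lemma words_uniq (K N : nat) : uniq (words K N).
Proof.
elim: N => //= N IH; apply: allpairs_uniq => //; first exact: iota_uniq.
by move=> [x s] [y t] _ _ /= [-> ->].
Qed.

Definition words_like (K : nat) (p : seq nat) : seq (seq nat) :=
  [seq u <- words K (size p) | uniq u && similar u p].

(** All rearrangements of all words with pattern [p] are different words: a rearrangement reveals
    the set of letters, which together with the pattern determines the original word. A pattern thus
    takes at most a fraction [1 / l!] of the words of length [l]. *)
Lemma size_words_like (K : nat) (p : seq nat) :
  (size p)`! * size (words_like K p) <= K ^ size p.
Proof.
set P := words_like K p.
have HP u : u \in P -> [/\ size u = size p, all (fun x => x < K) u, uniq u & similar u p].
  by rewrite mem_filter mem_words => /andP[/andP[-> ->] /andP[/eqP-> ->]].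
pose Q := [seq v | u <- P, v <- permutations u].
have sQ : size Q = (size p)`! * size P.
  rewrite size_allpairs_dep sumnE big_map.
  rewrite (eq_big_seq (fun=> (size p)`!)) ?big_const_seq ?count_predT ?iter_addn_0 //.
  by move=> u /HP[<- _ uu _]; rewrite size_permutations.
rewrite -sQ -size_words; apply: uniq_leq_size.
  apply: allpairs_uniq_dep; first by rewrite filter_uniq ?words_uniq.
    by move=> u _; apply: permutations_uniq.
  move=> [u a] [v b] /allpairsPdep[u' [a' [uP aP e1]]] /allpairsPdep[v' [b' [vP bP e2]]] /= eab.
  case: e1 => *; case: e2 => *; subst.
  have [_ _ uu su] := HP _ uP; have [_ _ _ sv] := HP _ vP.
  rewrite (_ : u' = v') //; apply: similar_perm_eq => //.
    by apply: similar_trans su _; rewrite similar_sym.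
  move: aP bP; rewrite !mem_permutations perm_sym => /perm_trans; exact.
move=> v /allpairsPdep[u [a [/HP[su Ku _ _] aP ->]]].
move: aP; rewrite mem_permutations => pau.
by rewrite mem_words (perm_size pau) su eqxx (perm_all _ pau).
Qed.

(** * Counting twin-free words *)

Definition twin_free_words (K l N : nat) : seq (seq nat) :=
  [seq w <- words K N | uniq w && ~~ has_twins l w].

Lemma has_twins_drop (l k : nat) (s : seq nat) : has_twins l (drop k s) -> has_twins l s.
Proof.
(* For [l = 0] the shifted positions could leave [s], since [k] may exceed [size s]; the empty twins
   at position 0 serve instead. *)
move=> /has_twinsP[i [j []]]; rewrite size_drop => ij jl sim; case: (leqP l 0) => [|l0].
  rewrite leqn0 => /eqP ->; apply/has_twinsP; exists 0, 0; split=> //; exact: similarxx.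
apply/has_twinsP; exists (i + k), (j + k); split; [lia|lia|].
by move: sim; rewrite /block !drop_drop.
Qed.

(** Twins that avoid the new first letter already lie in [s]; otherwise the left block is the prefix
    of length [l]. *)
Lemma has_twins_cons (l x : nat) (s : seq nat) :
  has_twins l (x :: s) -> has_twins l s \/
  exists2 j, j + l <= size (drop l (x :: s)) &
    similar (take l (x :: s)) (block (drop l (x :: s)) j l).
Proof.
move=> /has_twinsP[[|i] [j [ij jl sim]]].
  right; exists (j - l); first by rewrite size_drop; lia.
  by move: sim; rewrite /block drop_drop drop0 subnK.
case: j ij jl sim => // j ij jl sim; left; apply/has_twinsP; exists i, j; split=> //; lia.
Qed.

(** Each of the [K] extensions of a twin-free word is twin-free, repeats a letter, or creates twins.
    The factor [l!] avoids dividing in the bound on the last kind. *)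
Lemma twin_free_words_step (K l N : nat) : 0 < l ->
  l`! * (K * size (twin_free_words K l N)) <=
  l`! * (size (twin_free_words K l N.+1) + N * size (twin_free_words K l N)) +
  (l <= N.+1) * (size (twin_free_words K l (N.+1 - l)) * (N * K ^ l)).
Proof.
move=> l0; set S := twin_free_words K l.
have HS M w : (w \in S M) = [&& size w == M, all (fun x => x < K) w, uniq w & ~~ has_twins l w].
  by rewrite mem_filter mem_words andbC -!andbA.
(* The extensions rejected for a repeated letter lie in [D], those rejected for twins
   in [B]: the latter are determined by their last [N + 1 - l] letters [v], the
   position [j] in [v] of the twin of the first block, and that block [u]. *)
pose D := [seq x :: s | s <- S N, x <- s].
pose B := if l <= N.+1 then
  [seq p.2 ++ p.1.1 | p <- [seq (q, u) | q <- [seq (v, j) | v <- S (N.+1 - l), j <- iota 0 N],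
     u <- if q.2 + l <= size q.1 then words_like K (block q.1 q.2 l) else [::]]] else [::].
have sD : size D = N * size (S N).
  rewrite size_allpairs_dep sumnE big_map.
  rewrite (eq_big_seq (fun=> N)) ?big_const_seq ?count_predT ?iter_addn_0 //.
  by move=> w; rewrite HS => /andP[/eqP].
have sB : l`! * size B <= (l <= N.+1) * (size (S (N.+1 - l)) * (N * K ^ l)).
  rewrite /B; case: ifP => _; last by rewrite muln0.
  rewrite mul1n size_map size_allpairs_dep sumnE big_map big_distrr /=.
  rewrite mulnA -[X in _ <= _ * X * _](size_iota 0) -(size_allpairs pair).
  rewrite -sum1_size big_distrl /=; apply: leq_sum => -[v j] _ /=; rewrite mul1n.
  case: ifP => [jl|]; last by rewrite muln0.
  by have := size_words_like K (block v j l); rewrite size_block.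
apply: leq_trans (leq_add (leqnn _) sB); rewrite -mulnDr leq_mul2l; apply/orP; right.
rewrite -sD -!size_cat -[in X in X * _](size_iota 0 K) -(size_allpairs cons).
apply: uniq_leq_size.
  apply: allpairs_uniq; rewrite ?iota_uniq ?filter_uniq ?words_uniq //.
  by move=> [x s] [y t] _ _ /= [-> ->].
move=> _ /allpairsP[[x s] /= [xK sN ->]]; move: xK; rewrite mem_iota /= add0n => xK.
rewrite !mem_cat HS /= eqSS xK; have := sN; rewrite HS => /and4P[sNE sK us ntw].
rewrite sNE sK us /=; case: (boolP (x \in s)) => [xs|xs] /=.
  by apply/orP; left; apply/allpairsPdep; exists s, x.
case: (boolP (has_twins l (x :: s))) => //= tw; apply/orP; right.
have [|[j jl sim]] := has_twins_cons tw; first by move=> tws; rewrite tws in ntw.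
have szd : size (drop l (x :: s)) = N.+1 - l by rewrite size_drop /= (eqP sNE).
have lN : l <= N.+1 by move: jl; rewrite szd; lia.
rewrite /B lN; apply/mapP; exists ((drop l (x :: s), j), take l (x :: s)); last first.
  by rewrite /= cat_take_drop.
have uxs : uniq (x :: s) by rewrite /= xs.
have Kxs : all (fun x => x < K) (x :: s) by rewrite /= xK.
move: Kxs; rewrite -[in X in all _ X](cat_take_drop l (x :: s)) all_cat => /andP[Kt Kd].
have szt : size (take l (x :: s)) = l by rewrite size_takel //= (eqP sNE).
apply/allpairsPdep; exists (drop l (x :: s), j), (take l (x :: s)); split=> //.
  apply/allpairsP; exists (drop l (x :: s), j); rewrite mem_iota; split=> //=.
    2: by move: jl; rewrite szd; lia.
  (* As [l > 0], the remaining letters form a suffix of [s], hence inherit its twin-freeness. *)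
  rewrite HS szd eqxx drop_uniq //= Kd /=; apply: contra ntw.
  have -> : drop l (x :: s) = drop l.-1 s by case: (l) l0.
  exact: has_twins_drop.
by rewrite /= jl mem_filter mem_words take_uniq // sim size_block // szt eqxx.
Qed.

(* By induction on [N]: the growth by [K / 2] at the previous [l - 1] steps bounds the
   number of twin-free words of length [N + 1 - l], hence that of the excluded words. *)
Lemma twin_free_words_growth (n l N : nat) : 0 < l -> n * 2 ^ l.+1 <= l`! -> N < n ->
  4 * n * size (twin_free_words (4 * n) l N) <= 2 * size (twin_free_words (4 * n) l N.+1).
Proof.
(* With [K = 4 * n], repeated letters reject at most a quarter of the extensions and twins at most
   another quarter, so half survive. *)
move=> l0 nl; set K := 4 * n; set S := fun M => size (twin_free_words K l M).
rewrite -/(S N) -/(S N.+1).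
elim/ltn_ind: N => N IH Nn.
have growth m : m <= N -> K ^ m * S (N - m) <= 2 ^ m * S N.
  elim: m => [|m IHm] mN; first by rewrite !expn0 subn0.
  have := IH (N - m.+1); rewrite subnSK // => /(_ ltac:(lia) ltac:(lia)) step.
  rewrite !expnSr -mulnA (leq_trans (leq_mul (leqnn _) step)) //.
  by rewrite mulnCA -mulnA [leqRHS]mulnCA leq_mul2l IHm ?orbT // ltnW.
have step := twin_free_words_step K N l0; rewrite -/(S N) -/(S N.+1) in step.
have excluded : 4 * ((l <= N.+1) * (S (N.+1 - l) * (N * K ^ l))) <= l`! * (K * S N).
  case: (leqP l N.+1) => [lN|_] /=; last by rewrite mul0n muln0.
  have := growth l.-1 ltac:(lia); rewrite (_ : N - l.-1 = N.+1 - l); last by lia.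
  (* One factor of [K ^ l] is kept and the other [l - 1] are traded for [2 ^ (l - 1)]; then
     [4 * n * 2 ^ (l - 1) = n * 2 ^ (l + 1)] is at most [l!]. *)
  move=> gr; apply: leq_trans (leq_mul nl (leqnn (K * S N))).
  rewrite -[in K ^ l](prednK l0) -[in 2 ^ l.+1](prednK l0) !expnS mul1n.
  move: gr; move: (S _) (S N) (K ^ _) (2 ^ _) => a b c d gr.
  have -> : 4 * (a * (N * (K * c))) = 4 * N * K * (c * a) by lia.
  have -> : n * (2 * (2 * d)) * (K * b) = 4 * n * K * (d * b) by lia.
  by rewrite leq_mul // leq_mul // leq_mul // ltnW.
have f0 := fact_gt0 l.
have NK : 4 * (N * S N) <= K * S N by rewrite mulnA leq_mul2r /K leq_mul2l ltnW ?orbT.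
rewrite -(leq_pmul2l f0); move: excluded step; rewrite -/(S (N.+1 - l)).
set X := _ * (S (N.+1 - l) * _) => excluded step.
have NK' : l`! * (4 * (N * S N)) <= l`! * (K * S N) by rewrite leq_mul2l NK orbT.
nia.
Qed.

(** * Bounds on [bt] in terms of factorials *)

Lemma bt_lt_of_fact (n l : nat) : 0 < l -> n * 2 ^ l.+1 <= l`! -> bt n < l.
Proof.
move=> l0 nl; have [->|n0] := posnP n.
  by apply: (@bt_lt l [::]) => //; apply/has_twinsP => -[i [j [/= *]]]; lia.
(* Starting from the empty word, the growth inequality keeps the count positive up to length [n]. *)
have pos N : N <= n -> 0 < size (twin_free_words (4 * n) l N).
  elim: N => [|N IH] Nn.
    rewrite /twin_free_words /= ifT //=.
    by apply/has_twinsP => -[i [j [/= *]]]; lia.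
  have := twin_free_words_growth l0 nl Nn; have := IH (ltnW Nn); nia.
have := pos n (leqnn n); case E: (twin_free_words _ _ _) => [//|w r] _.
have : w \in twin_free_words (4 * n) l n by rewrite E mem_head.
rewrite mem_filter mem_words => /andP[/andP[uw ntw] /andP[/eqP <- _]].
exact: bt_lt.
Qed.

Lemma bt_ge_of_fact (n l : nat) : l * (l`!).+1 <= n -> l <= bt n.
Proof.
move=> ln; apply: bt_ge => s ps; have [->//|l0] := posnP l.
have us : uniq s by rewrite (perm_uniq ps) iota_uniq.
have ss : size s = n by rewrite (perm_size ps) size_iota.
apply: bt_perm_ge; apply: contraT => ntw.
pose pat (k : nat) := standardize (block s (k * l) l).
have kl k : k < (l`!).+1 -> k * l + l <= size s by move=> kf; rewrite ss; nia.
have sub : {subset [seq pat k | k <- iota 0 (l`!).+1] <= permutations (iota 1 l)}.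
  move=> _ /mapP[k + ->]; rewrite mem_iota add0n => /= kf.
  rewrite mem_permutations -[X in iota 1 X](size_block (kl k kf)).
  by apply: standardize_perm; rewrite take_uniq // drop_uniq.
(* Without twins the [l! + 1] blocks would have pairwise distinct patterns, more than there are. *)
suff up : uniq [seq pat k | k <- iota 0 (l`!).+1].
  have := uniq_leq_size up sub; rewrite size_map size_iota size_permutations ?iota_uniq //.
  by rewrite size_iota ltnn.
rewrite map_inj_in_uniq ?iota_uniq // => i j; rewrite !mem_iota !add0n /= => il jl e.
wlog ij : i j il jl e / i < j => [H|].
  by case: (ltngtP i j) => // [ij|ji]; [apply: H|apply/esym/H].
case/has_twinsP: ntw; exists (i * l), (j * l); split; [nia|exact: kl|].
apply: similar_trans (similar_standardize _); rewrite -/(pat j) -e similar_sym.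
exact: similar_standardize.
Qed.

(** * From factorials to powers *)

Lemma leq_bin_exp2 (n k : nat) : 'C(n, k) <= 2 ^ n.
Proof.
elim: n k => [|n IH] [|k]; rewrite ?bin0 ?expn_gt0 //.
by rewrite binS expnS mul2n -addnn leq_add.
Qed.

(** Each of the [l] factors of the falling factorial of [2 * l] is at least [l], and this falling
    factorial is [l!] times a central binomial coefficient. *)
Lemma leq_expn_fact (l : nat) : l ^ l <= 4 ^ l * l`!.
Proof.
have ff k : k <= l -> l ^ k <= (2 * l) ^_ k.
  elim: k => // k IH kl; rewrite expnSr ffactnSr leq_mul ?IH ?(ltnW kl) //; lia.
apply: leq_trans (ff l (leqnn l)) _; rewrite -bin_ffact leq_mul2r.
by rewrite (_ : 4 ^ l = 2 ^ (2 * l)) ?leq_bin_exp2 ?orbT // expnM.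
Qed.

Lemma leq_fact_expS (l : nat) : l * (l`!).+1 <= l.+1 ^ l.+1.
Proof.
have le_fact k : k`! <= k.+1 ^ k.
  elim: k => // k IH; rewrite factS expnS leq_mul //.
  by apply: leq_trans IH _; case: k => // k; rewrite leq_exp2r.
rewrite mulnS [X in _ <= X]expnS mulSn.
by apply: leq_add; [case: (l) => // k; rewrite ltnW // ltn_expl|rewrite leq_mul ?le_fact].
Qed.

Lemma bt_ge_of_exp (n m : nat) : m ^ m <= n -> m.-1 <= bt n.
Proof.
case: m => // m mn; apply: bt_ge_of_fact; exact: leq_trans (leq_fact_expS m) mn.
Qed.

(** Of [16 ^ l = 4 ^ l * 4 ^ l], one factor pays for replacing [l!] by [l ^ l], the other dominates
    [2 ^ (l + 1)]. *)
Lemma bt_lt_of_exp (n l : nat) : 0 < l -> n * 16 ^ l <= l ^ l -> bt n < l.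
Proof.
move=> l0 nl; apply: bt_lt_of_fact => //; rewrite -(@leq_pmul2l (4 ^ l)) ?expn_gt0 //.
apply: leq_trans (leq_trans _ nl) (leq_expn_fact l).
rewrite mulnCA leq_mul2l -[16]/(4 * 4) expnMn leq_mul2l expn_eq0 /=.
rewrite -[4]/(2 ^ 2) -expnM leq_exp2l //; apply/orP; right; lia.
Qed.

(** * Asymptotics over the reals *)

Local Open Scope classical_set_scope.
Local Open Scope ring_scope.

(** The inequality [ln (1 + y) <= y] at [y = c / 2 * x - 1] uses half of the slope; the other half
    absorbs the constants for large [x]. *)
Lemma ln_add_le_linear (R : realType) (c C : R) : 0 < c ->
  \forall x \near +oo, ln x + C <= c * x.
Proof.
move=> c0; near=> x.
have x0 : 0 < x by near: x; exact: nbhs_pinfty_gt.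
have d0 : 0 < c / 2 by rewrite divr_gt0.
have lnx : ln x = ln (c / 2 * x) - ln (c / 2).
  by rewrite lnM ?posrE // addrC addKr.
have := @le_ln1Dx R (c / 2 * x - 1); rewrite [1 + _]addrC subrK lnx.
have -> : -1 < c / 2 * x - 1 by have := mulr_gt0 d0 x0; lra.
move=> /(_ isT) H.
have : (C - ln (c / 2)) / (c / 2) <= x by near: x; apply: nbhs_pinfty_ge; exact: num_real.
rewrite ler_pdivrMr //; lra.
Unshelve. all: by end_near. Qed.

(** Let [m] be the integer part of [L / x]. Then [m <= L] gives [ln m <= x], so [m * ln m <= L] and
    [m ^ m <= n]. Truncation and the predecessor of [m] cost 1 each. *)
Lemma bt_ge_real (R : realType) (n : nat) :
  1 <= ln (ln (n%:R : R)) ->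
  ln (n%:R : R) / ln (ln n%:R) - 2 <= (bt n)%:R.
Proof.
set L := ln n%:R; set x := ln L => x1.
have x0 : 0 < x by lra.
have L0 : 0 < L by rewrite ltNge; apply/negP => /ln0 L0; move: x0; rewrite /x L0 ltxx.
have n0 : 0 < n%:R :> R by rewrite ltNge; apply/negP => /ln0 n0; move: L0; rewrite /L n0 ltxx.
have f0 : 0 < L / x by rewrite divr_gt0.
have /andP[mf fm] := truncn_itv (ltW f0); set m := Num.truncn _ in mf fm.
have : (m.-1 <= bt n)%N.
  apply: bt_ge_of_exp; rewrite -(ler_nat R) natrX.
  have [->|m0] := posnP m; first by rewrite expr0 ler1n -(ltr0n R).
  have mR0 : 0 < m%:R :> R by rewrite ltr0n.
  rewrite -ler_ln ?posrE ?exprn_gt0 // lnXn // -/L -[ln _ *+ m]mulr_natl.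
  have fL : L / x <= L by rewrite ler_pdivrMr // ler_peMr // ltW.
  have lnm : ln (m%:R : R) <= x by rewrite ler_ln ?posrE // (le_trans mf).
  have lnm0 : 0 <= ln (m%:R : R) by rewrite ln_ge0 // ler1n.
  have -> : L = L / x * x by rewrite divfK ?gt_eqF.
  exact: ler_pM.
rewrite -(ler_nat R); apply: le_trans; rewrite lerBlDr; apply: le_trans (ltW fm) _.
by rewrite -natrD ler_nat; lia.
Qed.

(** Take [l] just above [(1 + e) * (L / x)]. Then [ln l >= x - ln x], and the hypothesis on [ln x]
    leaves [ln l - ln 16 >= x / (1 + e)]; the product with [l] is at least [L], which is the
    logarithm of [n * 16 ^ l <= l ^ l]. *)
Lemma bt_le_real (R : realType) (e : R) (n : nat) : 0 < e ->
  1 <= ln (ln (n%:R : R)) ->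
  ln (ln (ln (n%:R : R))) + ln 16 <= e / (1 + e) * ln (ln (n%:R : R)) ->
  (bt n)%:R <= (1 + e) * (ln (n%:R : R) / ln (ln n%:R)).
Proof.
move=> e0; set L := ln n%:R; set x := ln L => x1 lnx.
have x0 : 0 < x by lra.
have L0 : 0 < L by rewrite ltNge; apply/negP => /ln0 L0; move: x0; rewrite /x L0 ltxx.
have n0 : 0 < n%:R :> R by rewrite ltNge; apply/negP => /ln0 n0; move: L0; rewrite /L n0 ltxx.
have f0 : 0 < L / x by rewrite divr_gt0.
have g0 : 0 < (1 + e) * (L / x) by rewrite mulr_gt0 //; lra.
have /andP[mg gm] := truncn_itv (ltW g0); set m := Num.truncn _ in mg gm.
apply: le_trans mg; rewrite ler_nat -ltnS; apply: bt_lt_of_exp => //.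
rewrite -(ler_nat R) natrM !natrX.
have mR0 : 0 < m.+1%:R :> R by rewrite ltr0n.
rewrite -ler_ln ?posrE ?mulr_gt0 ?exprn_gt0 // lnM ?posrE ?exprn_gt0 // !lnXn //.
rewrite -/L -[ln _ *+ _]mulr_natl -[ln m.+1%:R *+ _]mulr_natl -lerBrDr -mulrBr.
have fg : L / x <= (1 + e) * (L / x) by rewrite ler_peMl ?(ltW f0) //; lra.
have lnf : x - ln x <= ln (m.+1%:R : R).
  rewrite -ln_div ?posrE // ler_ln ?posrE //; exact: le_trans fg (ltW gm).
have gap : (1 + e)^-1 * x <= ln (m.+1%:R : R) - ln 16.
  have : (1 + e)^-1 * x = x - e / (1 + e) * x by field; lra.
  lra.
have -> : L = (1 + e) * (L / x) * ((1 + e)^-1 * x) by field; apply/andP; split; lra.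
apply: ler_pM gap => //; [exact: ltW| |exact: ltW].
by rewrite mulr_ge0 ?invr_ge0 ?(ltW x0) //; lra.
Qed.

Theorem theorem3p4 (R : realType) :
  exists eps : nat -> R,
    eps n @[n --> \oo] --> (0 : R) /\
    \forall n \near \oo,
      (bt n)%:R = (1 + eps n) * (ln (n%:R : R) / ln (ln (n%:R : R))).
Proof.
pose x (n : nat) : R := ln (ln n%:R).
pose f (n : nat) : R := ln n%:R / x n.
have x_pinfty : x n @[n --> \oo] --> +oo.
  apply/cvgryPge => A; near=> n.
  have n_large : expR (expR A) <= n%:R by near: n; exact: nbhs_infty_ger.
  have n0 : 0 < n%:R :> R := lt_le_trans (expR_gt0 _) n_large.
  have lnn : expR A <= ln n%:R by rewrite -[leLHS]expRK ler_ln ?posrE ?expR_gt0.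
  by rewrite -[leLHS]expRK ler_ln ?posrE ?expR_gt0 // (lt_le_trans (expR_gt0 A)).
have x_ge1 : \forall n \near \oo, 1 <= x n by move/cvgryPge: x_pinfty; exact.
have f_gt0 n : 1 <= x n -> 0 < f n.
  move=> x1; rewrite divr_gt0 //; last by lra.
  rewrite ltNge; apply/negP => /ln0 L0; move: x1; rewrite /x L0; lra.
exists (fun n => (bt n)%:R / f n - 1); split; last first.
  near=> n; have fn0 : 0 < f n by apply: f_gt0; near: n.
  by rewrite addrC subrK divfK // gt_eqF.
apply/cvgrPdist_le => e e0.
have c0 : 0 < e / (1 + e) by rewrite divr_gt0 //; lra.
near=> n.
have x1 : 1 <= x n by near: n.
have fn0 := f_gt0 n x1.
have upper : ln (x n) + ln 16 <= e / (1 + e) * x n.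
  by near: n; exact: (x_pinfty _ (ln_add_le_linear (ln 16) c0)).
(* Exponentiated, this says [2 / e * x n <= ln n], that is [2 <= e * f n], which absorbs the 2 lost
   in the lower bound. *)
have lower : ln (x n) + ln (2 / e) <= 1 * x n.
  by near: n; exact: (x_pinfty _ (ln_add_le_linear (ln (2 / e)) ltr01)).
have ef : 2 <= e * f n.
  have x0 : 0 < x n by lra.
  have L0 : 0 < ln (n%:R : R) by move: fn0; rewrite /f pmulr_lgt0 // invr_gt0.
  move: lower; rewrite mul1r -lnM ?posrE ?divr_gt0 // ler_ln ?posrE ?mulr_gt0 ?invr_gt0 //.
  by rewrite mulrA ler_pdivrMr // /f mulrA ler_pdivlMr // mulrC [_ * e]mulrC.
have ge := bt_ge_real x1; have le := bt_le_real e0 x1 upper.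
rewrite -/(x n) -/(f n) in ge le.
rewrite sub0r normrN ler_norml; apply/andP; split.
  by rewrite lerBrDr ler_pdivlMr //; lra.
by rewrite lerBlDr ler_pdivrMr //; lra.
Unshelve. all: by end_near. Qed.
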